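(* Let $X\sim\mathcal N(\mu,\Sigma)$ be an $m$-dimensional Gaussian random vector and let $A\perp\!\!\!\perp B\mid C$ be a CI statement. Then the variety of the CI ideal $J_{A\perp\!\!\!\perp B\mid C}\subset\mathbb C[\Sigma]$ is isomorphic to a Kazhdan-Lusztig variety $\mathcal N_{v,w}$ ($v,w\in S_n$, $n\geq m+1$) if $$v=(n-m,\dots,n,\ n-m-1,\dots,1)$$ and one of the following two conditions is satisfied: \begin{enumerate} \item $w=(n-l,\dots,n-l-k+1,\ n,\dots,n-l+1,\ n-l-k,\dots,1)$, where $l+k\le m$ and $A=[1,k]$, $B=[m-l+1,m]$, $C=\emptyset$; \item $w=(n,\ n-1-t,\dots,n-t-s,\ n-1,\dots,n-t,\ n-t-s-1,\dots,1)$, where $l+k=m+1$ for $k:=1+s$ and $l:=1+t$, and $A=[1,k-1]$, $B=[k+1,m]$, $C=\{k\}$. \end{enumerate}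
   Context: Permutations are in one-line notation; the first block $n-m,\dots,n$ of $v$ is increasing by steps of $1$ (and its second block is decreasing), while all blocks of $w$ are decreasing runs of consecutive integers. A permutation is identified with the permutation matrix with $1$s at $(w(j),j)$. For disjoint $A,B,C\subseteq[m]$ and $\Sigma$ a generic symmetric $m\times m$ matrix (the covariance matrix), the CI ideal is $J_{A\perp\!\!\!\perp B\mid C}=\langle (|C|+1)\text{-minors of }\Sigma_{A\cup C,B\cup C}\rangle\subseteq\mathbb C[\Sigma]$, where $\Sigma_{A\cup C,B\cup C}$ is the submatrix with rows $A\cup C$ and columns $B\cup C$ and $\mathbb C[\Sigma]$ is the polynomial ring in the $m(m+1)/2$ entries. The Kazhdan-Lusztig variety is $\mathcal N_{v,w}=\overline{BwB/B}\cap B_-vB/B\subset GL_n(\mathbb C)/B$, with $B$, $B_-$ the upper and lower triangular Borel subgroups. Equivalently, it is isomorphic to the set of matrices $Z$ with $1$s at the positions $(v(j),j)$, zeros at all positions north or east of such a $1$, and arbitrary other entries, such that for all $a,b$ the rank of the submatrix of $Z$ with rows $a,\dots,n$ and columns $1,\dots,b$ is at most the rank of the corresponding submatrix of $w$. *)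

(* Defs.v *)
From mathcomp Require Import all_boot all_order all_algebra all_fingroup.
From mathcomp Require Import boolp classical_sets reals.
From mathcomp Require Import complex.
From mathcomp Require Import mpoly.

Set Implicit Arguments.
Unset Strict Implicit.
Unset Printing Implicit Defensive.

Import Order.TTheory GRing.Theory Num.Theory.

Local Open Scope classical_set_scope.
Local Open Scope ring_scope.

(* Classical varieties over an algebraically closed field F are treated as
   spaces with functions: a topology together with, for each open set U, the
   F-valued functions that are regular on U.  Functions are total on points;
   [regular U f] only constrains the values of f on U. *)

Record fun_space (F : fieldType) := FunSpace {
  point :> Type;
  zopen : set (set point);
  regular : set point -> set (point -> F)
}.

Arguments zopen {F} _ _.
Arguments regular {F} _ _ _.

Section FunSpaces.
Variable F : fieldType.

Definition zclosed (X : fun_space F) (Z : set X) : Prop := zopen X (~` Z).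

Definition zclosure (X : fun_space F) (S : set X) : set X :=
  smallest (@zclosed X) S.

Definition peval (N : nat) (p : {mpoly F[N]}) (x : 'rV[F]_N) : F :=
  p.@[fun i => x 0 i].

(* Affine N-space: the sets where some polynomial does not vanish form a basis
   of the topology, and regular means locally a quotient of polynomials. *)
Definition affine_space (N : nat) : fun_space F :=
  @FunSpace F 'rV[F]_N
    (fun U => forall x, U x -> exists p : {mpoly F[N]},
       peval p x != 0 /\ forall y, peval p y != 0 -> U y)
    (fun U f => forall x, U x -> exists p q : {mpoly F[N]},
       peval q x != 0 /\
       forall y, U y -> peval q y != 0 -> f y = peval p y / peval q y).

(* Subspace topology; regular means locally the restriction of a regular
   function of the ambient space (the reduced structure when S is locally
   closed). *)
Definition subspace (X : fun_space F) (S : set X) : fun_space F :=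
  @FunSpace F {x : X | S x}
    (fun U => exists2 V, zopen X V & U = @proj1_sig X S @^-1` V)
    (fun U f => forall x : {x : X | S x}, U x -> exists V g,
       [/\ zopen X V, V (proj1_sig x), regular X V g &
           forall y : {x : X | S x}, U y -> V (proj1_sig y) ->
             f y = g (proj1_sig y)]).

Definition quot_class (X : fun_space F) (r : X -> X -> Prop) : Type :=
  {A : set X | exists x, A = [set y | r x y]}.

Definition quot_pi (X : fun_space F) (r : X -> X -> Prop) (x : X) :
    quot_class r :=
  exist _ [set y | r x y] (ex_intro _ x erefl).

(* Quotient by an equivalence relation r: quotient topology, and a function is
   regular when its pull-back is. *)
Definition quotient_space (X : fun_space F) (r : X -> X -> Prop) : fun_space F :=
  @FunSpace F (quot_class r)
    (fun U => zopen X ((@quot_pi X r) @^-1` U))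
    (fun U f => regular X ((@quot_pi X r) @^-1` U) (f \o @quot_pi X r)).

Definition isomorphic (X Y : fun_space F) : Prop :=
  exists (f : X -> Y) (g : Y -> X),
    [/\ cancel f g, cancel g f,
        forall U : set Y, zopen Y U <-> zopen X (f @^-1` U) &
        forall (U : set Y) (h : Y -> F), zopen Y U ->
          (regular Y U h <-> regular X (f @^-1` U) (h \o f))].

End FunSpaces.

Section CI.
Variable F : fieldType.

Definition generated_ideal (R : comNzRingType) (G : set R) : set R :=
  [set p | exists s : seq (R * R),
     (forall c, c \in s -> G c.2) /\ p = \sum_(c <- s) c.1 * c.2].

Definition zero_locus (N : nat) (I : set {mpoly F[N]}) :
    set (affine_space F N) :=
  [set x | forall p, I p -> peval p x = 0].

Definition variety_of (N : nat) (I : set {mpoly F[N]}) : fun_space F :=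
  subspace (zero_locus I).

(* Entries of a symmetric matrix are indexed by pairs i <= j, so the number of
   variables [nentries m] is m(m+1)/2. *)
Definition sym_index (m : nat) := {p : 'I_m * 'I_m | (p.1 <= p.2)%N}.

Definition nentries (m : nat) : nat := #|{: sym_index m}|.

Fact sym_pair_subproof (m : nat) (i j : 'I_m) :
  let p := if (i <= j)%N then (i, j) else (j, i) in (p.1 <= p.2)%N.
Proof. by rewrite /=; case: (leqP i j) => // /ltnW. Qed.

Definition sym_pair (m : nat) (i j : 'I_m) : sym_index m :=
  exist (fun p : 'I_m * 'I_m => (p.1 <= p.2)%N) _ (sym_pair_subproof i j).

Definition generic_sym (m : nat) : 'M[{mpoly F[nentries m]}]_m :=
  \matrix_(i, j) 'X_(enum_rank (sym_pair i j)).

(* The r-minors of the submatrix of M with rows P and columns Q; f and g list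
   the chosen rows and columns increasingly. *)
Definition minors (R : comNzRingType) (m : nat) (M : 'M[R]_m)
    (P Q : {set 'I_m}) (r : nat) : set R :=
  [set d | exists f g : 'I_r -> 'I_m,
     [/\ {homo f : i j / (i < j)%N}, {homo g : i j / (i < j)%N},
         (forall i, f i \in P), (forall i, g i \in Q) &
         d = \det (mxsub f g M)]].

Definition CI_ideal (m : nat) (A B C : {set 'I_m}) :
    set {mpoly F[nentries m]} :=
  generated_ideal (minors (@generic_sym m) (A :|: C) (B :|: C) #|C|.+1).

End CI.

Arguments generic_sym F m : clear implicits.
Arguments CI_ideal F {m} A B C.

Section KazhdanLusztig.
Variables (F : fieldType) (n : nat).

(* GL_n as an open subset of affine n^2-space, through [vec_mx]. *)
Definition GL : fun_space F :=
  subspace (X := affine_space F (n * n))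
    [set x : 'rV[F]_(n * n) | (vec_mx x : 'M[F]_n) \in unitmx].

Definition GL_mx (g : GL) : 'M[F]_n := vec_mx (proj1_sig g).

(* [is_trig_mx] means lower triangular. *)
Definition borel : set 'M[F]_n := [set b | b \in unitmx /\ is_trig_mx b^T].
Definition borel_opp : set 'M[F]_n := [set b | b \in unitmx /\ is_trig_mx b].

(* [flag_rel g h] says h \in gB. *)
Definition flag_rel (g h : GL) : Prop :=
  exists2 b, borel b & GL_mx h = GL_mx g *m b.

Definition flag_variety : fun_space F := quotient_space flag_rel.

(* 1s at (w j, j); note that [perm_mx w] has its 1s at (j, w j). *)
Definition permutation_matrix (w : 'S_n) : 'M[F]_n :=
  \matrix_(i, j) (i == w j)%:R.

(* HwB/B, for a set H of matrices. *)
Definition cell (H : set 'M[F]_n) (w : 'S_n) : set flag_variety :=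
  [set @quot_pi F GL flag_rel g | g in
     [set g : GL | exists h b, [/\ H h, borel b &
        GL_mx g = h *m permutation_matrix w *m b]]].

Definition KL_variety (v w : 'S_n) : fun_space F :=
  subspace (zclosure (cell borel w) `&` cell borel_opp v).

End KazhdanLusztig.

Arguments KL_variety F {n} v w.

(* Values in words and elements of [m] are counted from 1, those of 'I_n from 0. *)

Definition oneline (n : nat) (w : 'S_n) : seq nat :=
  [seq (nat_of_ord (w j)).+1 | j <- enum 'I_n].

(* a, a + 1, ..., b; empty when b < a. *)
Definition incr_run (a b : nat) : seq nat := iota a (b.+1 - a).

(* a, a - 1, ..., b; empty when a < b. *)
Definition decr_run (a b : nat) : seq nat := rev (incr_run b a).

Definition interval_set (m a b : nat) : {set 'I_m} :=
  [set i : 'I_m | (a <= i.+1 <= b)%N]%SET.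

(* Main.v *)
(* Both sides are described by one rank condition.  A point of the opposite cell
   B_- v B/B has a unique representative Z whose nontrivial part is an (m+1)x(m+1)
   lower unitriangular block in the bottom left corner; reading its strictly lower
   entries as the entries of a symmetric m x m matrix S identifies the cell with
   affine space.  In both cases of the theorem there are e (= |C|), p and q with
   p + q <= m + 1 such that the CI ideal says that the block of S with rows 1..q and
   columns m-p+1..m has rank <= e, which is the same as saying that the p x q south-west
   corner of Z has rank <= e.

   It remains to see that this corner condition cuts out the closure of BwB/B.  It is
   closed and holds on BwB.  Conversely, if the corner of g factors as a * b through
   an e-dimensional space, moving a, b and the other entries of g along segments
   towards those of the permutation matrix of w gives a curve of matrices with the
   same rank condition.  A generic point of the curve has an LU decomposition after
   reordering rows and columns, and the rank condition kills exactly those entries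
   of U that prevent it from lying in BwB.  Hence a polynomial that vanishes on BwB
   vanishes at g. *)
Require Import Defs.
From mathcomp Require Import boolp classical_sets mpoly zify ring.
From mathcomp Require Import all_boot all_order all_algebra all_fingroup.
From mathcomp Require Import reals complex.

Section KazhdanLusztigCI.

Set Implicit Arguments.
Unset Strict Implicit.
Unset Printing Implicit Defensive.

Import Order.TTheory GRing.Theory Num.Theory.

Local Open Scope classical_set_scope.
Local Open Scope ring_scope.

(** * Triangular matrices and LU decompositions *)

Section Triangular.
Variable F : fieldType.

Lemma is_trig_mulmx n (A B : 'M[F]_n) :
  is_trig_mx A -> is_trig_mx B -> is_trig_mx (A *m B).
Proof.
move=> /is_trig_mxP tA /is_trig_mxP tB; apply/is_trig_mxP => i j ij.
rewrite mxE big1 // => k _; case: (ltnP i k) => ik; first by rewrite tA ?mul0r.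
by rewrite tB ?mulr0 ?(leq_ltn_trans ik).
Qed.

Lemma trig_unitmx_diag n (A : 'M[F]_n) :
  is_trig_mx A -> (A \in unitmx) = [forall i, A i i != 0].
Proof.
move=> tA; rewrite unitmxE unitfE det_trig //.
by apply/prodf_neq0/forallP => h i //; apply: h.
Qed.

(** Forward substitution: earlier rows of [B] vanish to the right of the diagonal by induction,
    leaving [A i i * B i j = 0]. *)
Lemma is_trig_mulmxl n (A B : 'M[F]_n) : A \in unitmx ->
  is_trig_mx A -> is_trig_mx (A *m B) -> is_trig_mx B.
Proof.
move=> uA tA tAB; have := uA; rewrite trig_unitmx_diag // => /forallP nz.
apply/is_trig_mxP => i j; have [k] := ubnP (i : nat); elim: k i => // k IH i ik ij.
have /is_trig_mxP /(_ i j ij) := tAB.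
rewrite mxE (bigD1 i) //= big1 ?addr0 => [/eqP|l li].
  by rewrite mulf_eq0 (negPf (nz i)) => /eqP.
case: (ssrnat.ltngtP l i) => [h|h|/val_inj h]; last by rewrite h eqxx in li.
  by rewrite IH ?mulr0 ?(ltn_trans h ij) ?(leq_trans h).
by have /is_trig_mxP -> := tA; rewrite ?mul0r.
Qed.

Lemma is_trig_invmx n (A : 'M[F]_n) :
  A \in unitmx -> is_trig_mx A -> is_trig_mx (invmx A).
Proof.
by move=> uA tA; apply: (is_trig_mulmxl uA) => //; rewrite mulmxV ?scalar_mx_is_trig.
Qed.

Lemma borel1 n : borel (1%:M : 'M[F]_n).
Proof. by split; [apply: unitmx1|rewrite tr_scalar_mx scalar_mx_is_trig]. Qed.

Lemma borelM n (A B : 'M[F]_n) : borel A -> borel B -> borel (A *m B).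
Proof.
by move=> [uA tA] [uB tB]; split; rewrite ?unitmx_mul ?uA // trmx_mul is_trig_mulmx.
Qed.

Lemma borelV n (A : 'M[F]_n) : borel A -> borel (invmx A).
Proof.
move=> [uA tA]; split; first by rewrite unitmx_inv.
by rewrite trmx_inv is_trig_invmx ?unitmx_tr.
Qed.

Lemma borelP n (A : 'M[F]_n) : borel A -> forall i j : 'I_n, (j < i)%N -> A i j = 0.
Proof. by move=> [_ /is_trig_mxP tA] i j /tA; rewrite mxE. Qed.

(** Induction splitting off the last row and column; the new pivot is a Schur complement, nonzero
    because [M] itself is invertible. *)
Lemma leading_minors_LU n (M : 'M[F]_n) :
    (forall k (le_kn : (k <= n)%N),
       mxsub (widen_ord le_kn) (widen_ord le_kn) M \in unitmx) ->
  exists L U, [/\ M = L *m U, borel_opp L & borel U].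
Proof.
elim: n M => [|n IH].
  move=> M _; exists 1%:M, 1%:M.
  split; [by rewrite flatmx0 mulmx1 flatmx0 | split | exact: borel1].
    exact: unitmx1.
  exact: scalar_mx_is_trig.
rewrite -addn1 => M minM.
have [k le_kn|L [U [ME [uL tL] [uU tU]]]] := IH (ulsubmx M).
  have le_kn1 : (k <= n + 1)%N by rewrite (leq_trans le_kn) ?leq_addr.
  have -> // : mxsub (widen_ord le_kn) (widen_ord le_kn) (ulsubmx M)
        = mxsub (widen_ord le_kn1) (widen_ord le_kn1) M.
  by apply/matrixP => i j; rewrite !mxE; congr (M _ _); apply: val_inj.
pose L1 := block_mx L 0 (dlsubmx M *m invmx U) 1%:M.
pose U1 := block_mx U (invmx L *m ursubmx M) 0
  (drsubmx M - dlsubmx M *m invmx U *m (invmx L *m ursubmx M)).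
have uM : M \in unitmx.
  have <- : mxsub (widen_ord (leqnn _)) (widen_ord (leqnn _)) M = M.
    by apply/matrixP => i j; rewrite mxE; congr (M _ _); apply: val_inj.
  exact: minM.
have MLU : M = L1 *m U1.
  rewrite mulmx_block -ME !mul0mx !mulmx0 !mul1mx !addr0 mulKVmx // mulmxKV //.
  by rewrite [X in block_mx _ _ _ X]addrC subrK submxK.
have uLU : (L1 \in unitmx) && (U1 \in unitmx) by rewrite -unitmx_mul -MLU.
have [uL1 uU1] := andP uLU.
exists L1, U1; split=> //; split=> //.
  by rewrite is_trig_block_mx // eqxx tL mx11_is_trig.
by rewrite tr_block_mx trmx0 is_trig_block_mx // eqxx tU mx11_is_trig.
Qed.

(* Gaussian elimination never leaves the support {v i >= v j}, and it never
   changes the diagonal because v is injective. *)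
Lemma conj_lower_LU n (v : 'I_n -> nat) (M : 'M[F]_n) : injective v ->
    (forall i, M i i != 0) -> (forall i j, (v i < v j)%N -> M i j = 0) ->
  exists L U, [/\ M = L *m U, borel U, (forall i, L i i = 1),
    (forall i j : 'I_n, (i < j)%N -> L i j = 0) &
    (forall i j, (v i < v j)%N -> L i j = 0)].
Proof.
elim: n v M => [|n IH] v M inj_v nz supp.
  exists 1%:M, 1%:M; split; [|exact: borel1|by case..].
  by rewrite [LHS]flatmx0 [RHS]flatmx0.
move: M nz supp; change (n.+1) with (1 + n)%N => M nz supp.
pose a := M 0 0; pose x := ursubmx M; pose y := dlsubmx M.
have ulE : ulsubmx M = a%:M.
  by rewrite [LHS]mx11_scalar !mxE; congr (M _ _)%:M; apply: val_inj.
have lsh0 : lshift n (0 : 'I_1) = 0 by apply: val_inj.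
have xy0 i j : (v (rshift 1 i) < v (rshift 1 j))%N \/ i = j -> y i 0 * x 0 j = 0.
  move=> vij; rewrite !mxE lsh0.
  case: (ltnP (v (rshift 1 i)) (v 0)) => h1; first by rewrite supp ?mul0r.
  case: (ltnP (v 0) (v (rshift 1 j))) => h2; first by rewrite [M 0 _]supp ?mulr0.
  case: vij => vij; first by have := leq_ltn_trans (leq_trans h2 h1) vij; rewrite ltnn.
  have /inj_v/(congr1 val) // : v (rshift 1 i) = v 0.
  by apply/eqP; rewrite eqn_leq h1 [X in v (rshift 1 X)]vij h2.
pose M' := drsubmx M - a^-1 *: (y *m x).
have [||i j vij|L [U [ME [uU tU] L1 Llo Lsupp]]] := IH (fun i => v (rshift 1 i)) M'.
- by move=> i j /inj_v/(congr1 val)/= [] /val_inj.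
- by move=> i; rewrite !mxE big_ord1 xy0 ?mulr0 ?subr0; [apply: nz|right].
- by rewrite !mxE big_ord1 xy0 ?mulr0 ?subr0; [apply: supp|left].
have a0 : a != 0 by apply: nz.
pose L' := block_mx (1%:M : 'M_1) 0 (a^-1 *: y) L.
pose U' := block_mx (a%:M : 'M_1) x 0 U.
exists L', U'; split.
- rewrite mulmx_block !mul1mx !mul0mx !mulmx0 !addr0 -ME mul_mx_scalar scalerA divff //.
  by rewrite scale1r -scalemxAl addrC subrK -ulE submxK.
- split; first by rewrite unitmxE det_ublock unitrM det_scalar expr1 unitfE a0 -unitmxE.
  by rewrite tr_block_mx trmx0 is_trig_block_mx // eqxx mx11_is_trig tU.
- move=> i; case: (split_ordP i) => k ->; last by rewrite block_mxEdr.
  by rewrite block_mxEul ord1 mxE eqxx.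
- move=> i j; case: (split_ordP i) => k ->; case: (split_ordP j) => l ->.
  + by rewrite !ord1 ltnn.
  + by rewrite block_mxEur mxE.
  + by rewrite /= ord1.
  + by rewrite block_mxEdr /= !add1n ltnS => /Llo.
- move=> i j; case: (split_ordP i) => k ->; case: (split_ordP j) => l ->.
  + by rewrite !ord1 ltnn.
  + by rewrite block_mxEur mxE.
  + rewrite block_mxEdl !mxE ord1 => h; rewrite supp ?mulr0 //.
  + by rewrite block_mxEdr => /Lsupp.
Qed.

End Triangular.

(** * Rank conditions and minors *)

Section Rank.
Variable F : fieldType.

(* "The P x Q block of M has rank <= e", as a factorization through F^e; this
   transfers along any reindexing and deforms with its two factors. *)
Definition rank_on (I J : Type) (P : pred I) (Q : pred J) (e : nat)
    (M : I -> J -> F) : Prop :=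
  exists (a : I -> 'I_e -> F) (b : J -> 'I_e -> F),
    forall i j, P i -> Q j -> M i j = \sum_k a i k * b j k.

Lemma ltn_enum_val n (S : {set 'I_n}) (i j : 'I_#|S|) :
  (i < j)%N -> (enum_val i < enum_val j)%N.
Proof.
move=> ij; have x0 := enum_val i.
rewrite !(enum_val_nth x0) -!(nth_map x0 (val x0) val) -?cardE //.
apply: (sorted_ltn_nth ltn_trans); rewrite ?inE ?size_map -?cardE //.
rewrite sorted_map /enum_mem -enumT; apply: sorted_filter.
  by move=> ? ? ?; apply: ltn_trans.
by rewrite -sorted_map val_enum_ord iota_ltn_sorted.
Qed.

(** [maxrankfun] selects independent rows in no prescribed order, while [minors] wants increasing
    index functions; enumerating the set of selected rows sorts them and keeps their span. *)
Lemma increasing_row_free k m n (X : 'M[F]_(m, n)) : (k <= \rank X)%N ->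
  exists f : 'I_k -> 'I_m,
    {homo f : i j / (i < j)%N} /\ row_free (rowsub f X).
Proof.
move=> le_k; pose h i := maxrankfun X (widen_ord le_k i).
have inj_h : injective h by move=> i j /maxrankfun_inj/(congr1 val)/= /val_inj.
pose S := [set h i | i : 'I_k]%SET.
have cardS : #|S| = k by rewrite card_imset ?card_ord.
have free_h : row_free (rowsub h X).
  have -> : rowsub h X = rowsub (widen_ord le_k) (rowsub (maxrankfun X) X).
    by rewrite -mxsub_comp.
  apply/row_freeP; have /row_freeP [B XB] := maxrowsub_free X.
  exists (colsub (widen_ord le_k) B); apply/matrixP => i j.
  move/matrixP/(_ (widen_ord le_k i) (widen_ord le_k j)): XB; rewrite !mxE => <-.
  by apply: eq_bigr => l _; rewrite !mxE.
exists (fun i => enum_val (cast_ord (esym cardS) i)); split.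
  by move=> i j ij; apply: ltn_enum_val.
rewrite -row_leq_rank; apply: leq_trans (_ : \rank (rowsub h X) <= _)%N.
  by rewrite row_leq_rank.
apply/mxrankS/row_subP => i; rewrite row_rowsub.
have hS : h i \in S by apply: imset_f.
have -> : h i = enum_val (cast_ord (esym cardS)
    (cast_ord cardS (enum_rank_in hS (h i)))).
  by rewrite cast_ordK enum_rankK_in.
by rewrite -(row_rowsub (fun i => enum_val (cast_ord (esym cardS) i))) row_sub.
Qed.

Lemma rank_on_minors m (M : 'M[F]_m) (P Q : {set 'I_m}) e :
  rank_on (mem P) (mem Q) e M <-> forall d, minors M P Q e.+1 d -> d = 0.
Proof.
split=> [[a [b Mab]] d [f [g [_ _ fP gQ ->]]]|minors0].
  apply/eqP; apply: contraT => nz.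
  have -> // : false = (e.+1 <= e)%N by rewrite ltnn.
  have MAB : mxsub f g M = \matrix_(i < e.+1, k < e) a (f i) k *m
      \matrix_(k < e, j < e.+1) b (g j) k.
    apply/matrixP => i j; rewrite !mxE Mab; [|exact: fP|exact: gQ].
    by apply: eq_bigr => k _; rewrite !mxE.
  have /mxrank_unit {1}<- : mxsub f g M \in unitmx by rewrite unitmxE unitfE.
  by rewrite MAB (leq_trans (mxrankM_maxl _ _)) ?rank_leq_col.
(* Zeroing the entries outside P x Q forces the rows and columns of any nonsingular submatrix of [X]
   to lie in P and Q. *)
pose X : 'M[F]_m := \matrix_(i, j) if (i \in P) && (j \in Q) then M i j else 0.
have : (\rank X <= e)%N.
  rewrite leqNgt; apply/negP => lt_e.
  have [f [incr_f free_f]] := increasing_row_free lt_e.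
  have : (e.+1 <= \rank (rowsub f X)^T)%N by rewrite mxrank_tr row_leq_rank.
  move=> /increasing_row_free [g [incr_g free_g]].
  have unitX : mxsub f g X \in unitmx.
    have -> : mxsub f g X = (rowsub g (rowsub f X)^T)^T.
      by apply/matrixP => i j; rewrite !mxE.
    by rewrite unitmx_tr -row_free_unit.
  have fP i : f i \in P.
    apply: contraT => nfP; move: unitX.
    rewrite unitmxE unitfE (expand_det_row _ i) big1 ?eqxx // => j _.
    by rewrite !mxE (negPf nfP) mul0r.
  have gQ j : g j \in Q.
    apply: contraT => ngQ; move: unitX.
    rewrite unitmxE unitfE (expand_det_col _ j) big1 ?eqxx // => i _.
    by rewrite !mxE (negPf ngQ) andbF mul0r.
  move: unitX; rewrite unitmxE unitfE (minors0 (\det (mxsub f g X))) ?eqxx //.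
  exists f, g; split=> //.
  by congr (\det _); apply/matrixP => i j; rewrite !mxE fP gQ.
move=> le_e.
(* The rank normal form of [X], split through dimension [e], which is at least the rank. *)
pose a : 'M[F]_(m, e) := col_ebase X *m pid_mx (\rank X).
pose b : 'M[F]_(e, m) := pid_mx (\rank X) *m row_ebase X.
have XE : X = a *m b.
  rewrite /a /b !mulmxA -[_ *m pid_mx _ *m pid_mx _]mulmxA.
  by rewrite pid_mx_id ?mulmx_ebase.
exists (fun i => a i), (fun j k => b k j) => i j iP jQ.
by have := congr1 (fun A => fun_of_matrix A i j) XE;
  rewrite !mxE (iP : i \in P) (jQ : j \in Q).
Qed.

End Rank.

(** * Charts of quotient spaces *)

Section RationalMaps.
Variable F : fieldType.

(** One denominator serves all coordinates, so the domain is a principal open set. *)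
Definition ratmap N M (a : 'I_N -> {mpoly F[M]}) (d : {mpoly F[M]})
    (y : 'rV[F]_M) : 'rV[F]_N :=
  \row_i (peval (a i) y / peval d y).

(** Clearing denominators monomial by monomial. The numerator and the exponent do not depend on [y],
    so openness and regularity pull back. *)
Lemma peval_ratmap N M (a : 'I_N -> {mpoly F[M]}) (d : {mpoly F[M]})
    (p : {mpoly F[N]}) :
  exists (q : {mpoly F[M]}) (k : nat), forall y, peval d y != 0 ->
    peval p (ratmap a d y) = peval q y / peval d y ^+ k.
Proof.
elim/mpolyind: p => [|c m p _ _ [q [k pq]]].
  by exists 0, 0%N => y _; rewrite /peval !meval0 mul0r.
exists (c *: \prod_i a i ^+ m i * d ^+ k + q * d ^+ (\sum_i m i)), (\sum_i m i + k)%N.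
move=> y dy; have := pq y dy; rewrite /peval => pE.
rewrite !mevalD pE mevalZ mevalX !mevalM !mevalZ !rmorphXn /= rmorph_prod /=.
set e := meval _ d in dy *.
have -> : \prod_(i < N) ratmap a d y 0 i ^+ m i
    = (\prod_(i < N) meval (fun i => y 0 i) (a i ^+ m i)) / e ^+ (\sum_i m i).
  rewrite expr_sum -prodfV -big_split; apply: eq_bigr => i _.
  by rewrite !mxE expr_div_n rmorphXn.
rewrite exprD; have ek n : e ^+ n != 0 by rewrite expf_neq0.
move: (ek k) (ek (\sum_i m i)%N); move: (e ^+ k) (e ^+ _) => u w u0 w0.
by field; rewrite u0 w0.
Qed.

Lemma zopen_ratmap N M (a : 'I_N -> {mpoly F[M]}) (d : {mpoly F[M]})
    (U : set (affine_space F N)) : zopen (affine_space F N) U ->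
  zopen (affine_space F M) [set y | peval d y != 0 /\ U (ratmap a d y)].
Proof.
move=> oU y [dy Uy]; have [p [py pU]] := oU _ Uy.
have [q [k pq]] := peval_ratmap a d p.
exists (q * d); rewrite /peval mevalM mulf_eq0 negb_or dy andbT; split.
  by move: py; rewrite pq // mulf_eq0 negb_or => /andP[].
move=> z; rewrite mevalM mulf_eq0 negb_or => /andP[qz dz]; split=> //.
by apply: pU; rewrite pq // mulf_neq0 // invr_neq0 // expf_neq0.
Qed.

Lemma regular_ratmap N M (a : 'I_N -> {mpoly F[M]}) (d : {mpoly F[M]})
    (U : set (affine_space F N)) h : regular (affine_space F N) U h ->
  regular (affine_space F M)
    [set y | peval d y != 0 /\ U (ratmap a d y)] (h \o ratmap a d).
Proof.
move=> rU y [dy Uy]; have [p [q [qy hE]]] := rU _ Uy.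
have [p' [k pp]] := peval_ratmap a d p.
have [q' [l qq]] := peval_ratmap a d q.
exists (p' * d ^+ l), (q' * d ^+ k); split.
  move: qy; rewrite qq // mulf_eq0 negb_or => /andP[q'y _].
  by rewrite /peval mevalM rmorphXn mulf_neq0 // expf_neq0.
move=> z [dz Uz]; rewrite /peval !mevalM !rmorphXn mulf_eq0 negb_or /= => /andP[q'z _].
rewrite hE // ?pp ?qq ?mulf_neq0 ?invr_neq0 ?expf_neq0 //.
rewrite /peval in dz *; move: (expf_neq0 k dz) (expf_neq0 l dz).
by move: (_ ^+ k) (_ ^+ l) => u w u0 w0; field; rewrite u0 w0 q'z.
Qed.

Lemma zopenI N (U V : set (affine_space F N)) :
  zopen (affine_space F N) U -> zopen (affine_space F N) V ->
  zopen (affine_space F N) (U `&` V).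
Proof.
move=> oU oV x [/oU [p [px pU]] /oV [q [qx qV]]]; exists (p * q).
rewrite /peval mevalM mulf_neq0 //; split=> // y.
by rewrite mevalM mulf_eq0 negb_or => /andP[? ?]; split; [apply: pU|apply: qV].
Qed.

Lemma regularS N (U V : set (affine_space F N)) h : U `<=` V ->
  regular (affine_space F N) V h -> regular (affine_space F N) U h.
Proof.
move=> UV rV x /UV /rV [p [q [qx hE]]]; exists p, q; split=> // y /UV; exact: hE.
Qed.

End RationalMaps.

(* Phi : A^N -> G and Psi : {d <> 0} -> A^N are the two directions of a chart; Psi is
   constant on the classes of r, so {d <> 0} is saturated and Psi descends to an open
   subset of the quotient that contains S. *)
Section Chart.
Variables (F : fieldType) (N M : nat) (D : set (affine_space F M)).
Let G : fun_space F := subspace D.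
Variable r : G -> G -> Prop.
Hypothesis r_refl : forall g, r g g.
Hypothesis r_sym : forall g h, r g h -> r h g.
Hypothesis r_trans : forall g h k, r g h -> r h k -> r g k.
Let Q := quotient_space r.
Let pi : G -> Q := @quot_pi F G r.

Lemma quot_piP (g h : G) : pi g = pi h <-> r g h.
Proof.
split=> [/(congr1 (@proj1_sig _ _)) /= gh|rgh].
  by have : [set y | r h y] h by []; rewrite -gh.
apply: (@eq_exist _ _ [set y | r g y]); apply/seteqP.
by split=> k /=; [move/(r_trans (r_sym rgh))|move/(r_trans rgh)].
Qed.

(** A representative obtained by choice; [r_inv] makes [dom] and [psi] independent of it. *)
Let rep (y : Q) : G := sval (cid (svalP y)).

Lemma quot_pi_rep y : pi (rep y) = y.
Proof.
have: sval y = [set k | r (rep y) k] := svalP (cid (svalP y)).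
by case: y => A e /= AE; apply: eq_exist; rewrite -AE.
Qed.

Variables (phi : 'I_M -> {mpoly F[N]}) (a : 'I_N -> {mpoly F[M]}) (d : {mpoly F[M]}).
Let Phi := ratmap phi 1.
Let Psi := ratmap a d.
Hypothesis PhiD : forall x, D (Phi x).
Hypothesis dPhi : forall x, peval d (Phi x) != 0.
Hypothesis PhiK : forall x, Psi (Phi x) = x.
Hypothesis r_inv : forall g h : G, r g h -> peval d (proj1_sig g) != 0 ->
  peval d (proj1_sig h) != 0 /\ Psi (proj1_sig h) = Psi (proj1_sig g).
Let PhiG x : G := exist _ (Phi x) (PhiD x).
Variables (T : set (affine_space F N)) (S : set Q).
Hypothesis TS : forall x, T x <-> S (pi (PhiG x)).
Hypothesis S_img : forall y, S y -> exists x, y = pi (PhiG x).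

Let dom (y : Q) : Prop := peval d (proj1_sig (rep y)) != 0.
Let psi (y : Q) : 'rV[F]_N := Psi (proj1_sig (rep y)).

Lemma chart_dom g : dom (pi g) <-> peval d (proj1_sig g) != 0.
Proof.
have rg : r (rep (pi g)) g by apply/quot_piP; rewrite quot_pi_rep.
by split=> /r_inv; [case/(_ _ rg)|case/(_ _ (r_sym rg))].
Qed.

Lemma chart_val g : peval d (proj1_sig g) != 0 -> psi (pi g) = Psi (proj1_sig g).
Proof.
have rg : r g (rep (pi g)) by apply/quot_piP; rewrite quot_pi_rep.
by case/(r_inv rg).
Qed.

Let up (O : set 'rV[F]_N) : set Q := [set y | dom y /\ O (psi y)].

Lemma chart_up_preim O : pi @^-1` up O =
  @proj1_sig _ D @^-1` [set y | peval d y != 0 /\ O (Psi y)].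
Proof.
apply/seteqP; split=> g /=; rewrite /up /=.
  by move=> [/chart_dom dg]; rewrite chart_val.
by move=> [dg Og]; rewrite chart_val //; split=> //; apply/chart_dom.
Qed.

Lemma zopen_up O : zopen (affine_space F N) O -> zopen Q (up O).
Proof.
move=> oO; exists [set y | peval d y != 0 /\ O (Psi y)]; first exact: zopen_ratmap.
exact: chart_up_preim.
Qed.

Lemma regular_up O h : zopen (affine_space F N) O ->
  regular (affine_space F N) O h -> regular Q (up O) (h \o psi).
Proof.
move=> oO rh g Og; exists [set y | peval d y != 0 /\ O (Psi y)], (h \o Psi); split.
- exact: zopen_ratmap.
- by move: Og; rewrite -/(pi @^-1` up O) chart_up_preim.
- exact: regular_ratmap.
- by move=> k _ [dk _] /=; rewrite chart_val.
Qed.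

Let down (V : set Q) : set 'rV[F]_N := [set x | V (pi (PhiG x))].

Lemma zopen_Phi V : zopen (affine_space F M) V ->
  zopen (affine_space F N) (Phi @^-1` V).
Proof.
move=> /(@zopen_ratmap _ _ _ phi 1); congr (zopen (affine_space F N) _).
apply/seteqP; split=> x /=; first by case.
by rewrite /peval meval1 oner_eq0.
Qed.

Lemma zopen_down V : zopen Q V -> zopen (affine_space F N) (down V).
Proof.
move=> [W oW VW]; have -> : down V = Phi @^-1` W; last exact: zopen_Phi.
by apply/seteqP; split=> x /=; have /seteqP [+ +] := VW;
  [move=> /(_ (PhiG x)) + _|move=> _ /(_ (PhiG x))].
Qed.

(** Only local: a regular function on the subspace [G] extends to the ambient affine space merely
    near each point, so [h'] depends on [x]. *)
Lemma regular_down V h x : zopen Q V -> regular Q V h -> down V x ->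
  exists O h', [/\ zopen (affine_space F N) O, O x,
    regular (affine_space F N) O h', O `<=` down V &
    forall z, O z -> h (pi (PhiG z)) = h' z].
Proof.
move=> oV rh Vx; have [W [k [oW Wx rk hk]]] := rh (PhiG x) Vx.
exists (Phi @^-1` W `&` down V), (k \o Phi); split=> //.
- by apply: zopenI; [exact: zopen_Phi|exact: zopen_down].
- apply: (regularS _ (@regular_ratmap F M N phi 1 W k rk)) => z [Wz _]; split=> //.
  by rewrite /peval meval1 oner_eq0.
- by move=> z [Wz Vz]; exact: (hk (PhiG z)).
Qed.

(** The chart and [psi] restrict to inverse bijections of [T] and [S]. Open sets and regular
    functions on either side are restrictions of ambient ones, which [up] and [down] transport. *)
Lemma chart_isomorphic : isomorphic (subspace T) (subspace S).
Proof.
have psiPhi x : psi (pi (PhiG x)) = x by rewrite chart_val ?dPhi //; exact: PhiK.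
have psiK y : S y -> pi (PhiG (psi y)) = y by move=> /S_img [x ->]; rewrite psiPhi.
have psiT y : S y -> T (psi y) by move=> Sy; apply/TS; rewrite psiK.
have Sdom y : S y -> dom y by move=> /S_img [x ->]; apply/chart_dom/dPhi.
pose f (x : subspace T) : subspace S := exist S _ ((TS _).1 (svalP x)).
pose g (y : subspace S) : subspace T := exist T _ (psiT _ (svalP y)).
have fK : cancel f g by case=> x Tx; apply: eq_exist; exact: psiPhi.
have gK : cancel g f by case=> y Sy; apply: eq_exist; exact: psiK.
exists f, g; split=> // [U|U h oU].
  split=> [[V oV ->]|[O oO fU]].
    by exists (down V); first exact: zopen_down.
  exists (up O); first exact: zopen_up.
  apply/seteqP; split=> y.
    rewrite -{1}(gK y) -[U _]/((f @^-1` U) (g y)) fU => Oy; split=> //.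
    exact: Sdom (svalP y).
  by case=> _ Oy; rewrite -(gK y) -[U _]/((f @^-1` U) (g y)) fU.
split=> rh.
  move=> x Ux; have [V [k [oV Vx rk hk]]] := rh (f x) Ux.
  have [O [k' [oO Ox rk' OV kk']]] := regular_down oV rk Vx.
  exists O, k'; split=> // z Uz Oz /=; rewrite -kk' //; exact: (hk (f z) Uz (OV _ Oz)).
move=> y; rewrite -{1}(gK y) => Uy; have [O [k [oO Oy rk hk]]] := rh (g y) Uy.
exists (up O), (k \o psi); split.
- exact: zopen_up.
- by split=> //; apply: Sdom (svalP y).
- exact: regular_up.
- move=> z; rewrite -{1}(gK z) => Uz [_ Oz] /=.
  by rewrite -[z in LHS](gK z) -[LHS]/((h \o f) (g z)) hk.
Qed.

End Chart.

(** * Flags and the Bruhat cell of w *)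

Lemma ltn_rev_ord n (i j : 'I_n) : (rev_ord i < rev_ord j)%N = (j < i)%N.
Proof. by move: (ltn_ord i) (ltn_ord j) => /=; lia. Qed.

Section Flags.
Variables (F : fieldType) (n : nat).

Lemma flag_rel_refl (g : GL F n) : flag_rel g g.
Proof. by exists 1%:M; [exact: borel1|rewrite mulmx1]. Qed.

Lemma flag_rel_sym (g h : GL F n) : flag_rel g h -> flag_rel h g.
Proof.
move=> [b bB hE]; exists (invmx b); first exact: borelV.
by rewrite hE mulmxK //; case: bB.
Qed.

Lemma flag_rel_trans (g h k : GL F n) : flag_rel g h -> flag_rel h k -> flag_rel g k.
Proof.
move=> [b bB hE] [c cB kE]; exists (b *m c); first exact: borelM.
by rewrite kE hE mulmxA.
Qed.

Lemma permutation_matrix_unit (w : 'S_n) : permutation_matrix F w \in unitmx.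
Proof.
have -> : permutation_matrix F w = perm_mx w^-1.
  by apply/matrixP => i j; rewrite !mxE (canF_eq (permKV w)) eq_sym.
exact: unitmx_perm.
Qed.

Lemma mul_permutation_matrix (w : 'S_n) (A : 'M[F]_n) i j :
  (A *m permutation_matrix F w) i j = A i (w j).
Proof.
rewrite mxE (bigD1 (w j)) //= big1 ?addr0 => [|k kwj].
  by rewrite mxE eqxx mulr1.
by rewrite mxE (negPf kwj) mulr0.
Qed.

Definition entries_mx : 'M[{mpoly F[n * n]}]_n := vec_mx (\row_k 'X_k).

Lemma peval_minor k (f g : 'I_k -> 'I_n) (y : 'rV[F]_(n * n)) :
  peval (\det (mxsub f g entries_mx)) y = \det (mxsub f g (vec_mx y)).
Proof.
rewrite /peval -det_map_mx; congr (\det _); apply/matrixP => i j.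
by rewrite !mxE /= mevalXU.
Qed.

(** As [b] is upper triangular, the first k columns of [A *m b] involve only the first k columns of
    [A]. *)
Lemma minor_mulmx_borel k (f : 'I_k -> 'I_n) (le_kn : (k <= n)%N) (A b : 'M[F]_n) :
  borel b ->
  \det (mxsub f (widen_ord le_kn) (A *m b)) = \det (mxsub f (widen_ord le_kn) A) *
    \det (mxsub (widen_ord le_kn) (widen_ord le_kn) b).
Proof.
move=> bB; rewrite -det_mulmx; congr (\det _); apply/matrixP => i j.
rewrite !mxE (bigID (fun l : 'I_n => (l < k)%N)) /= [X in _ + X]big1 ?addr0 => [|l].
  by rewrite (big_ord_narrow le_kn); apply: eq_bigr => l _; rewrite !mxE.
rewrite -leqNgt => kl; rewrite (borelP bB) ?mulr0 //=.
exact: leq_trans (ltn_ord j) kl.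
Qed.

Lemma leading_minor_borel k (le_kn : (k <= n)%N) (b : 'M[F]_n) :
  borel b -> \det (mxsub (widen_ord le_kn) (widen_ord le_kn) b) != 0.
Proof.
move=> [ub tb]; rewrite -det_tr.
have tb' : is_trig_mx (mxsub (widen_ord le_kn) (widen_ord le_kn) b)^T.
  apply/is_trig_mxP => i j ij; have /is_trig_mxP := tb.
  by move=> /(_ (widen_ord le_kn i) (widen_ord le_kn j) ij); rewrite !mxE.
rewrite det_trig //; apply/prodf_neq0 => i _; rewrite !mxE.
move: ub; rewrite -unitmx_tr trig_unitmx_diag // => /forallP.
by move=> /(_ (widen_ord le_kn i)); rewrite mxE.
Qed.

End Flags.

Section RankOn.
Variable F : fieldType.

(** Columns in Q are combined only with columns in Q, so [b] is absorbed into the second factor. *)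
Lemma rank_on_mulr n (P Q : {set 'I_n}) e (M b : 'M[F]_n) :
  (forall k j, j \in Q -> k \notin Q -> b k j = 0) ->
  rank_on (mem P) (mem Q) e M -> rank_on (mem P) (mem Q) e (M *m b).
Proof.
move=> b0 [x [y MM]]; exists x, (fun j k => \sum_(l in Q) y l k * b l j).
move=> i j iP jQ; rewrite mxE (bigID (mem Q)) /= [X in _ + X]big1 ?addr0; last first.
  by move=> l lQ; rewrite (b0 l j) ?mulr0.
under eq_bigr => l lQ do rewrite MM // mulr_suml.
rewrite exchange_big; apply: eq_bigr => k _; rewrite mulr_sumr.
by apply: eq_bigr => l _; rewrite mulrA.
Qed.

Lemma rank_on_mull n (P Q : {set 'I_n}) e (h M : 'M[F]_n) :
  (forall i k, i \in P -> k \notin P -> h i k = 0) ->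
  rank_on (mem P) (mem Q) e M -> rank_on (mem P) (mem Q) e (h *m M).
Proof.
move=> h0 [x [y MM]]; exists (fun i k => \sum_(l in P) h i l * x l k), y.
move=> i j iP jQ; rewrite mxE (bigID (mem P)) /= [X in _ + X]big1 ?addr0; last first.
  by move=> l lP; rewrite (h0 i l) ?mul0r.
under eq_bigr => l lP do rewrite MM // mulr_sumr.
rewrite exchange_big; apply: eq_bigr => k _; rewrite mulr_suml.
by apply: eq_bigr => l _; rewrite mulrA.
Qed.

End RankOn.

(* The corner consists of the rows i >= n - p and the columns j < q (counted from 0).
   The hypotheses say that it contains no 1 of w outside the first e columns, and that
   w differs from the longest permutation only in pairs with a column j in [e, q) and
   a row >= n - p. *)
Section BruhatCell.
Variables (F : fieldType) (n p q e : nat) (w : 'S_n).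
Hypotheses (le_ep : (e <= p)%N) (le_eq : (e <= q)%N) (le_en : (e <= n)%N).
Hypothesis w_top : forall j : 'I_n, (j < e)%N -> w j = rev_ord j.
Hypothesis w_noninv : forall i j : 'I_n, (j < i)%N -> (w j < w i)%N ->
  [/\ (e <= j)%N, (j < q)%N & (n - p <= w i)%N].
Hypothesis w_corner : forall j : 'I_n, (j < q)%N -> (n - p <= w j)%N -> (j < e)%N.

Definition low_rows : {set 'I_n} := [set i : 'I_n | (n - p <= i)%N]%SET.
Definition left_cols : {set 'I_n} := [set j : 'I_n | (j < q)%N]%SET.

Definition corner_rank (M : 'M[F]_n) := rank_on (mem low_rows) (mem left_cols) e M.

(** Factors of the corner of the permutation matrix of [w]: its only 1s there are in the columns k <
    e, at the rows n - 1 - k. *)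
Definition top_row (i : 'I_n) (k : 'I_e) : F := (i == rev_ord (widen_ord le_en k))%:R.
Definition top_col (j : 'I_n) (k : 'I_e) : F := (j == widen_ord le_en k)%:R.

Lemma permutation_corner i j : i \in low_rows -> j \in left_cols ->
  permutation_matrix F w i j = \sum_k top_row i k * top_col j k.
Proof.
rewrite !inE => iP jQ; rewrite mxE; case: (ltnP j e) => je.
  rewrite (bigD1 (Ordinal je)) //= big1 => [|k kj].
    rewrite addr0 /top_row /top_col.
    have -> : widen_ord le_en (Ordinal je) = j by apply: val_inj.
    by rewrite eqxx mulr1 w_top.
  rewrite /top_col; case: eqP => [jk|_]; last by rewrite mulr0.
  by case/eqP: kj; apply: val_inj; rewrite /= {1}jk.
rewrite big1 => [|k _]; last first.
  rewrite /top_col; case: eqP => [jk|_]; last by rewrite mulr0.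
  by move: je; rewrite jk /= leqNgt ltn_ord.
case: eqP => // iwj; move: je; rewrite leqNgt w_corner -?iwj //.
Qed.

Lemma corner_rank_mull h M : borel h -> corner_rank M -> corner_rank (h *m M).
Proof.
move=> hB; apply: rank_on_mull => i k; rewrite !inE -ltnNge => iP kP.
by rewrite (borelP hB) // (leq_trans kP).
Qed.

Lemma corner_rank_mulr b M : borel b -> corner_rank M -> corner_rank (M *m b).
Proof.
move=> bB; apply: rank_on_mulr => k j; rewrite !inE -leqNgt => jQ kQ.
by rewrite (borelP bB) // (leq_trans jQ).
Qed.

Lemma corner_rank_cell (h b : 'M[F]_n) : borel h -> borel b ->
  corner_rank (h *m permutation_matrix F w *m b).
Proof.
move=> hB bB; apply: corner_rank_mulr => //; apply: corner_rank_mull => //.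
by exists top_row, top_col => i j; apply: permutation_corner.
Qed.

(* Reordering rows by w_0 and columns by w turns membership in BwB into an LU
   decomposition g' = L U in which the conjugate of U by w_0 w is upper triangular.
   The entries of U that have to vanish for this lie in a block whose rank, by the
   corner condition, is already used up by the leading e x e block of U. *)
Lemma corner_rank_generic (g : 'M[F]_n) : corner_rank g ->
    (forall k (le_kn : (k <= n)%N), \det (mxsub (fun i => rev_ord (widen_ord le_kn i))
       (fun j => (w^-1)%g (rev_ord (widen_ord le_kn j))) g) != 0) ->
  exists h b, [/\ borel h, borel b & g = h *m permutation_matrix F w *m b].
Proof.
move=> [x [y gE]] nz.
pose g' := mxsub (@rev_ord n) (fun j => (w^-1)%g (rev_ord j)) g.
have [k le_kn|L [U [gLU [uL tL] UB]]] := @leading_minors_LU _ _ g'.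
  rewrite unitmxE unitfE -mxsub_comp; exact: nz.
have [uU tU] := UB.
pose h := mxsub (@rev_ord n) (@rev_ord n) L.
pose b := mxsub (fun i => rev_ord (w i)) (fun i => rev_ord (w i)) U.
(* Row r of U = L^-1 g' uses only rows s <= r of [g'] since L^-1 is lower triangular. For r < p
   these rows belong to the corner, so the factorization of [g] passes to [U]. *)
pose x' r k := \sum_(s < n) invmx L r s * x (rev_ord s) k.
have UE (r j : 'I_n) : (r < p)%N -> (j < q)%N ->
    U r (rev_ord (w j)) = \sum_k x' r k * y j k.
  move=> rp jq; have -> : U = invmx L *m g' by rewrite gLU mulKmx.
  rewrite mxE; under [RHS]eq_bigr => k _ do rewrite mulr_suml.
  rewrite exchange_big; apply: eq_bigr => s _; rewrite mxE rev_ordK permK.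
  under eq_bigr => k _ do rewrite -mulrA.
  rewrite -mulr_sumr; case: (ltnP r s) => rs.
    by have /is_trig_mxP -> := is_trig_invmx uL tL; rewrite ?mul0r.
  by rewrite gE ?inE //= leq_sub2l // (leq_ltn_trans rs).
(* By [w_top] the leading e x e block of [U] factors through [Y], which is therefore invertible. A
   row r >= e of [U] is zero in the first e columns, so its factor [x' r] is zero. *)
have U0 (r j : 'I_n) : (e <= r)%N -> (r < p)%N -> (j < q)%N -> U r (rev_ord (w j)) = 0.
  move=> er rp jq; pose Y := \matrix_(k < e, j < e) y (widen_ord le_en j) k.
  have XY (s : 'I_n) : (s < p)%N ->
      (\row_k x' s k) *m Y = \row_(j < e) U s (widen_ord le_en j).
    move=> sp; apply/rowP => i; rewrite !mxE.
    have -> : widen_ord le_en i = rev_ord (w (widen_ord le_en i)).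
      by rewrite w_top ?rev_ordK //=.
    rewrite UE //; last exact: leq_trans (ltn_ord i) le_eq.
    by apply: eq_bigr => k _; rewrite !mxE.
  have uY : Y \in unitmx.
    have := leading_minor_borel le_en UB; rewrite -unitfE -unitmxE.
    have -> : mxsub (widen_ord le_en) (widen_ord le_en) U =
        (\matrix_(i < e, k < e) x' (widen_ord le_en i) k) *m Y.
      apply/row_matrixP => i; rewrite row_mul.
      have -> : row i (\matrix_(i < e, k < e) x' (widen_ord le_en i) k) =
          \row_k x' (widen_ord le_en i) k by apply/rowP => k; rewrite !mxE.
      rewrite XY; last exact: leq_trans (ltn_ord i) le_ep.
      by apply/rowP => k; rewrite !mxE.
    by rewrite unitmx_mul => /andP[].
  have x'0 : \row_k x' r k = 0.
    rewrite -[LHS](mulmxK uY) XY // [X in X *m _](_ : _ = 0) ?mul0mx //.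
    apply/rowP => i; rewrite !mxE (borelP UB) //=.
    exact: leq_trans (ltn_ord i) er.
  rewrite UE // big1 // => k _; move/rowP/(_ k): x'0; rewrite !mxE => ->.
  by rewrite mul0r.
exists h, b; split.
- have th : is_trig_mx h^T.
    apply/is_trig_mxP => i j ij; rewrite !mxE; have /is_trig_mxP -> // := tL.
    by rewrite ltn_rev_ord.
  split=> //; rewrite -unitmx_tr trig_unitmx_diag //; apply/forallP => i.
  by rewrite !mxE; move: uL; rewrite trig_unitmx_diag // => /forallP.
- have tb : is_trig_mx b^T.
    apply/is_trig_mxP => j i ji; rewrite !mxE.
    (* If w j < w i the entry lies above the diagonal of [U], and [w_noninv] places it in the block
       killed by [U0]. *)
    case: (ltnP (w j) (w i)) => wji; last first.
      rewrite (borelP UB) // ltn_rev_ord ltn_neqAle wji andbT.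
      by apply: contraTneq ji => /val_inj/perm_inj ->; rewrite ltnn.
    have [ej jq piw] := w_noninv ji wji.
    apply: U0 => //.
      (* Otherwise [w_top] gives i = rev_ord (w i) < e, against e <= j < i. *)
      rewrite leqNgt; apply/negP => lt_e.
      have := @w_top (rev_ord (w i)) lt_e; rewrite rev_ordK => /perm_inj wi.
      by move: lt_e; rewrite wi ltnNge (leq_trans ej) // ltnW.
    by have := ltn_ord (w i); rewrite /=; lia.
  split=> //; rewrite -unitmx_tr trig_unitmx_diag //; apply/forallP => i.
  rewrite !mxE; move: uU; rewrite -unitmx_tr trig_unitmx_diag // => /forallP.
  by move=> /(_ (rev_ord (w i))); rewrite mxE.
- apply/matrixP => i j; rewrite mxE.
  under eq_bigr => k _ do rewrite mul_permutation_matrix !mxE.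
  have -> : g i j = g' (rev_ord i) (rev_ord (w j)) by rewrite mxE !rev_ordK permK.
  rewrite gLU mxE (reindex (fun k => rev_ord (w k))) //=.
  exists (fun k => (w^-1)%g (rev_ord k)) => k _.
    by rewrite rev_ordK permK.
  by rewrite permKV rev_ordK.
Qed.

End BruhatCell.

(** * Curves of matrices and the closure of the Bruhat cell *)

Lemma peval_curve (F : fieldType) N (p : {mpoly F[N]}) (c : 'rV[{poly F}]_N) :
  exists q : {poly F}, forall t, q.[t] = peval p (map_mx (horner_eval t) c).
Proof.
elim/mpolyind: p => [|a m p _ _ [q qE]].
  by exists 0 => t; rewrite horner0 /peval meval0.
exists (a%:P * \prod_i c 0 i ^+ m i + q) => t.
rewrite hornerD hornerM hornerC horner_prod qE /peval mevalD mevalZ mevalX.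
by congr (_ * _ + _); apply: eq_bigr => i _; rewrite horner_exp mxE.
Qed.

(** In characteristic 0 the natural numbers below [size p] are distinct, giving too many roots. *)
Lemma poly_eq0_pointwise (F : numFieldType) (p : {poly F}) :
  (forall t, p.[t] = 0) -> p = 0.
Proof.
move=> p0; apply/eqP; apply: contraT => nz.
have := @max_poly_roots _ p [seq i%:R | i <- iota 0 (size p)] nz.
rewrite size_map size_iota ltnn => -> //.
  by apply/allP => x _; rewrite rootE p0.
by rewrite map_inj_uniq ?iota_uniq // => i j /eqP; rewrite eqr_nat => /eqP.
Qed.

Lemma horner_segment (R : comNzRingType) (x y t : R) :
  ((1 - 'X) * x%:P + 'X * y%:P).[t] = (1 - t) * x + t * y.
Proof. by rewrite hornerD !hornerM !hornerC hornerD hornerN !hornerE. Qed.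

Section Closure.
Variables (F : numFieldType) (n p q e : nat) (w : 'S_n).
Hypotheses (le_ep : (e <= p)%N) (le_eq : (e <= q)%N) (le_en : (e <= n)%N).
Hypothesis w_top : forall j : 'I_n, (j < e)%N -> w j = rev_ord j.
Hypothesis w_noninv : forall i j : 'I_n, (j < i)%N -> (w j < w i)%N ->
  [/\ (e <= j)%N, (j < q)%N & (n - p <= w i)%N].
Hypothesis w_corner : forall j : 'I_n, (j < q)%N -> (n - p <= w j)%N -> (j < e)%N.

Let crank (g : 'M[F]_n) := corner_rank p q e g.
Let piG (g : GL F n) : flag_variety F n := @quot_pi F (GL F n) (@flag_rel F n) g.

Lemma piG_eq g h : piG g = piG h <-> flag_rel g h.
Proof.
exact: (quot_piP (@flag_rel_refl F n) (@flag_rel_sym F n) (@flag_rel_trans F n)).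
Qed.

Lemma corner_rank_flag g h : piG g = piG h -> crank (GL_mx g) -> crank (GL_mx h).
Proof. by move=> /piG_eq [b bB ->]; apply: corner_rank_mulr. Qed.

(** The complement pulls back to the union of the principal open sets of the (e+1)-minors of the
    corner; invariance under [flag_rel] makes one representative decide. *)
Lemma corner_rank_closed : zclosed [set y | forall g, piG g = y -> crank (GL_mx g)].
Proof.
pose V := [set y : 'rV[F]_(n * n) | exists2 d : {mpoly F[n * n]},
  peval d y != 0 & minors (entries_mx F n) (low_rows n p) (left_cols n q) e.+1 d].
exists V => [y [d dy md]|].
  by exists d; split=> // z dz; exists d.
have minorE g (d : {mpoly F[n * n]}) :
    minors (entries_mx F n) (low_rows n p) (left_cols n q) e.+1 d ->
    minors (GL_mx g) (low_rows n p) (left_cols n q) e.+1 (peval d (sval g)).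
  by move=> [f [f' [hf hf' fP fQ ->]]]; exists f, f'; split=> //; rewrite peval_minor.
apply/seteqP; split=> g.
  move=> ng; apply: contrapT => nV; apply: ng => h hg.
  apply: corner_rank_flag (esym hg) _; apply/rank_on_minors.
  move=> d [f [f' [hf hf' fP fQ ->]]]; apply: contrapT => nz; apply: nV.
  exists (\det (mxsub f f' (entries_mx F n))); last by exists f, f'.
  by rewrite peval_minor; apply/eqP.
move=> [d dg /(minorE g) md] /(_ g erefl) /rank_on_minors /(_ _ md) d0.
by move: dg; rewrite d0 eqxx.
Qed.

Lemma leading_minor_permutation k (le_kn : (k <= n)%N) :
  mxsub (fun i => rev_ord (widen_ord le_kn i))
    (fun j => (w^-1)%g (rev_ord (widen_ord le_kn j))) (permutation_matrix F w) = 1%:M.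
Proof.
apply/matrixP => i j; rewrite !mxE permKV (inj_eq rev_ord_inj).
by congr (_%:R).
Qed.

Lemma closure_cellP (g : GL F n) :
  zclosure (cell (@borel F n) w) (piG g) <-> crank (GL_mx g).
Proof.
split=> [cl|[a [b ab]]].
  pose K := [set y | forall g, piG g = y -> crank (GL_mx g)].
  suff : K (piG g) by apply.
  apply: cl; split; first exact: corner_rank_closed.
  move=> _ [g0 [h [b [hB bB g0E]]] <-] g1 /esym /corner_rank_flag; apply.
  by rewrite g0E; apply: corner_rank_cell.
move=> Z [[W oW WE] cellZ]; apply: contrapT => nZ.
have Wg : W (sval g) by have : (piG @^-1` ~` Z) g by []; rewrite /piG WE.
have [d [dg dW]] := oW _ Wg.
(* The curve from g at 0 to the permutation matrix at 1. *)
pose c : 'M[{poly F}]_n := \matrix_(i, j)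
  if (i \in low_rows n p) && (j \in left_cols n q) then
    \sum_k ((1 - 'X) * (a i k)%:P + 'X * (top_row F le_en i k)%:P) *
           ((1 - 'X) * (b j k)%:P + 'X * (top_col F le_en j k)%:P)
  else (1 - 'X) * (GL_mx g i j)%:P + 'X * (permutation_matrix F w i j)%:P.
pose ev t := map_mx (horner_eval t) c.
have evE t i j : ev t i j = (c i j).[t] by rewrite mxE.
have ev0 : ev 0 = GL_mx g.
  apply/matrixP => i j; rewrite evE mxE; case: ifP => [/andP[iP jQ]|_].
    rewrite horner_sum ab //; apply: eq_bigr => k _.
    by rewrite hornerM !horner_segment; ring.
  by rewrite horner_segment; ring.
have ev1 : ev 1 = permutation_matrix F w.
  apply/matrixP => i j; rewrite evE mxE; case: ifP => [/andP[iP jQ]|_].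
    rewrite horner_sum (permutation_corner F le_en w_top w_corner) //.
    by apply: eq_bigr => k _; rewrite hornerM !horner_segment; ring.
  by rewrite horner_segment; ring.
have ev_rank t : crank (ev t).
  exists (fun i k => ((1 - 'X) * (a i k)%:P + 'X * (top_row F le_en i k)%:P).[t]),
    (fun j k => ((1 - 'X) * (b j k)%:P + 'X * (top_col F le_en j k)%:P).[t]) => i j iP jQ.
  rewrite evE mxE (iP : i \in _) (jQ : j \in _) horner_sum.
  by apply: eq_bigr => k _; rewrite hornerM.
pose minor k (le_kn : (k <= n)%N) : {poly F} :=
  \det (mxsub (fun i => rev_ord (widen_ord le_kn i))
    (fun j => (w^-1)%g (rev_ord (widen_ord le_kn j))) c).
have minorE k (le_kn : (k <= n)%N) t : (minor k le_kn).[t] =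
    \det (mxsub (fun i => rev_ord (widen_ord le_kn i))
      (fun j => (w^-1)%g (rev_ord (widen_ord le_kn j))) (ev t)).
  rewrite -horner_evalE -det_map_mx; congr (\det _).
  by apply/matrixP => i j; rewrite !mxE.
(* [D] is 1 at t = 1, where every reordered leading minor is that of an identity matrix; so the
   generic point of the curve satisfies [corner_rank_generic]. *)
pose D := \prod_(k < n.+1) minor k (leq_ord k).
have D1 : D != 0.
  apply: contraTneq isT => D0.
  have : D.[1] = 1; last by rewrite D0 horner0 => /esym /eqP; rewrite oner_eq0.
  rewrite horner_prod big1 // => k _.
  by rewrite minorE ev1 leading_minor_permutation det1.
have [d' d'E] := peval_curve d (mxvec c).
(* Where [D] does not vanish, [ev t] lies in the cell and hence in [Z], so [d] must vanish there.
   This gives d' = 0, although d' at 0 is the nonzero value of [d] at [g]. *)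
have d'D : d' * D = 0.
  apply: poly_eq0_pointwise => t; rewrite hornerM.
  have [->|Dt] := eqVneq D.[t] 0; first by rewrite mulr0.
  have [k le_kn|h [b' [hB bB evhb]]] :=
    corner_rank_generic le_ep le_eq le_en w_top w_noninv (ev_rank t).
    pose k' : 'I_n.+1 := Ordinal (le_kn : (k < n.+1)%N).
    move: Dt; rewrite horner_prod => /prodf_neq0 /(_ k' isT).
    by rewrite minorE (bool_irrelevance (leq_ord k' : (k <= n)%N) le_kn).
  have uev : ev t \in unitmx.
    by rewrite evhb !unitmx_mul permutation_matrix_unit; case: hB => ->; case: bB => ->.
  have [dt|dt] := eqVneq (peval d (mxvec (ev t))) 0.
    by rewrite d'E map_mxvec dt mul0r.
  have uv : (vec_mx (mxvec (ev t)) : 'M[F]_n) \in unitmx by rewrite mxvecK.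
  pose g' : GL F n := exist _ (mxvec (ev t)) uv.
  have : (piG @^-1` ~` Z) g' by rewrite /piG WE; exact: dW dt.
  case; apply: cellZ; exists g' => //; exists h, b'; split=> //.
  by rewrite -evhb /GL_mx /= mxvecK.
have d'0 : d'.[0] != 0.
  by rewrite d'E map_mxvec -/(ev 0) ev0 /GL_mx vec_mxK.
move/eqP: d'D; rewrite mulf_eq0 (negPf D1) orbF => /eqP d0.
by rewrite d0 horner0 eqxx in d'0.
Qed.

End Closure.

(** * The opposite cell of v *)

(* The junk value 0 for i or j out of range is never used. *)
Definition nat_entry (R : nmodType) m (M : 'M[R]_m) (i j : nat) : R :=
  if (insub i, insub j) is (Some k, Some l) then M k l else 0.

Lemma nat_entryE (R : nmodType) m (M : 'M[R]_m) (i j : 'I_m) : nat_entry M i j = M i j.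
Proof. by rewrite /nat_entry !valK. Qed.

Lemma nat_entry_ord (R : nmodType) m (M : 'M[R]_m) i j (im : (i < m)%N) (jm : (j < m)%N) :
  nat_entry M i j = M (Ordinal im) (Ordinal jm).
Proof. exact: nat_entryE (Ordinal im) (Ordinal jm). Qed.

Section OppositeCell.
Variables (F : fieldType) (m n : nat) (v : 'S_n).
Hypothesis lt_mn : (m < n)%N.
Hypothesis v_first : forall r : 'I_n, (r <= m)%N -> v r = (n - m.+1 + r)%N :> nat.
Hypothesis v_last : forall r : 'I_n, (m < r)%N -> v r = (n - r.+1)%N :> nat.

(** [v] increases on the positions 0..m, then decreases through smaller values. *)
Lemma v_noninv (c r : 'I_n) : (c < r)%N -> (v c < v r)%N = (r <= m)%N.
Proof.
have := ltn_ord r; case: (leqP r m) => rm; case: (leqP c m) => cm.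
- by rewrite !v_first //; lia.
- by lia.
- by rewrite v_first // v_last //; lia.
- by rewrite !v_last //; lia.
Qed.

(* The normal form Z of a point of the opposite cell, with Z (v r, c) = M (c, r - 1)
   for c < r <= m; only the upper triangle of M is used. *)
Definition cell_mx (R : pzSemiRingType) (M : 'M[R]_m) : 'M[R]_n :=
  \matrix_(i, c) let r := (v^-1)%g i in
    if (c < r <= m)%N then nat_entry M c r.-1 else (r == c)%:R.

Lemma cell_mxE (R : pzSemiRingType) (M : 'M[R]_m) (r c : 'I_n) : cell_mx M (v r) c =
  if (c < r <= m)%N then nat_entry M c r.-1 else (r == c)%:R.
Proof. by rewrite mxE permK. Qed.

Lemma map_cell_mx (R S : pzSemiRingType) (f : {rmorphism R -> S}) (M : 'M[R]_m) :
  map_mx f (cell_mx M) = cell_mx (map_mx f M).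
Proof.
apply/matrixP => i c; rewrite !mxE /=; case: ifP => _; last by rewrite rmorph_nat.
rewrite /nat_entry; case: (insub (c : nat) : option 'I_m) => [k|]; last by rewrite raddf0.
by case: (insub _ : option 'I_m) => [l|]; rewrite ?raddf0 // mxE.
Qed.

Definition to_opp (M : 'M[F]_m) : 'M[F]_n := \matrix_(i, j) cell_mx M i ((v^-1)%g j).

Lemma to_oppE M : cell_mx M = to_opp M *m permutation_matrix F v.
Proof. by apply/matrixP => i j; rewrite mul_permutation_matrix [RHS]mxE permK. Qed.

Lemma to_opp_borel M : borel_opp (to_opp M).
Proof.
have t : is_trig_mx (to_opp M).
  apply/is_trig_mxP => i j; rewrite -(permKV v i) -(permKV v j).
  move: ((v^-1)%g i) ((v^-1)%g j) => r c rc; rewrite mxE permK cell_mxE.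
  case: ifP => [/andP[cr rm]|_].
    by move: rc; rewrite ltnNge ltnW // v_noninv.
  by case: eqP => // rc'; rewrite rc' ltnn in rc.
split=> //; rewrite trig_unitmx_diag //; apply/forallP => i.
by rewrite -(permKV v i) mxE permK cell_mxE ltnn eqxx oner_eq0.
Qed.

Lemma cell_mx_unit (M : 'M[F]_m) : cell_mx M \in unitmx.
Proof.
by rewrite to_oppE unitmx_mul permutation_matrix_unit andbT; case: (to_opp_borel M).
Qed.

(** [rowx] shifts by one: the symmetric index pairs c <= r become the strictly lower positions c < r
    + 1. *)
Definition colx (c : 'I_m) : 'I_n := widen_ord (ltnW lt_mn) c.
Definition rowx (r : 'I_m) : 'I_n := Ordinal (leq_ltn_trans (ltn_ord r) lt_mn).

Lemma cell_mx_coord (R : pzSemiRingType) (M : 'M[R]_m) (c r : 'I_m) : (c <= r)%N ->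
  cell_mx M (v (rowx r)) (colx c) = M c r.
Proof. by move=> cr; rewrite cell_mxE /= ltnS cr ltn_ord nat_entryE. Qed.

Lemma cell_mx_upper (R : pzSemiRingType) (M M' : 'M[R]_m) :
  (forall c r : 'I_m, (c <= r)%N -> M c r = M' c r) -> cell_mx M = cell_mx M'.
Proof.
move=> MM'; apply/matrixP => i c; rewrite !mxE /=; case: ifP => // /andP[cr rm].
have r1 : (((v^-1)%g i).-1 < m)%N by lia.
have c1 : (c < m)%N by lia.
by rewrite !nat_entry_ord MM' //=; lia.
Qed.

(** Conjugating by [v] reduces this to [conj_lower_LU]. An off-diagonal entry (r, c) of the
    resulting [L] survives only if c < r and v c < v r, that is c < r <= m by [v_noninv]. *)
Lemma opp_cell_normal_form (h : 'M[F]_n) : borel_opp h ->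
  exists (M : 'M[F]_m) U, borel U /\ h *m permutation_matrix F v = cell_mx M *m U.
Proof.
move=> [uh th]; pose M := mxsub v v h.
have inj_v : injective (fun i => val (v i)) by move=> i j /val_inj/perm_inj.
have [||L [U [ME UB L1 Llo Lv]]] := conj_lower_LU inj_v (M := M).
- by move=> i; rewrite mxE; move: uh; rewrite trig_unitmx_diag // => /forallP.
- by move=> i j vij; rewrite mxE; have /is_trig_mxP -> := th.
exists (\matrix_(c, r) L (rowx r) (colx c)), U; split=> //.
have LE : cell_mx (\matrix_(c, r) L (rowx r) (colx c)) = \matrix_(i, c) L ((v^-1)%g i) c.
  apply/matrixP => i c; rewrite -(permKV v i) cell_mxE mxE permK.
  move: ((v^-1)%g i) => r; case: ifP => [/andP[cr rm]|crm].
    have r1 : (r.-1 < m)%N by lia.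
    have c1 : (c < m)%N by lia.
    rewrite nat_entry_ord mxE; congr (L _ _); apply: val_inj => //=.
    by rewrite prednK // (leq_ltn_trans _ cr).
  case: eqP => [->|/eqP rc]; first by rewrite L1.
  have [cr|rc'] := ltnP c r; last first.
    by rewrite Llo // ltn_neqAle rc' andbT; apply: contra rc => /eqP/val_inj ->.
  rewrite Lv // ltn_neqAle leqNgt v_noninv // -(andTb (r <= m)%N) -{1}cr crm andbT.
  by apply: contra rc => /eqP/val_inj/perm_inj ->.
apply/matrixP => i j; rewrite LE mul_permutation_matrix.
have -> : h i (v j) = M ((v^-1)%g i) j by rewrite mxE permKV.
by rewrite ME !mxE; apply: eq_bigr => k _; rewrite mxE.
Qed.

(* If v^-1 Z = L U with L unitriangular then the entry (r, c) of L is the quotient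
   of the minors on rows v 0, ..., v (c - 1), v r and v 0, ..., v c. *)
Definition chart_rows (c r : 'I_n) (i : 'I_c.+1) : 'I_n :=
  if (i < c)%N then v (widen_ord (ltn_ord c) i) else v r.

Definition chart_minor (R : pzRingType) (A : 'M[R]_n) (c r : 'I_n) : R :=
  \det (mxsub (chart_rows r) (widen_ord (ltn_ord c)) A).

(** The submatrix is lower triangular, with 1s on the diagonal except for the last entry, which is
    the one sought. *)
Lemma chart_minor_cell_mx (R : comNzRingType) (M : 'M[R]_m) (c r : 'I_n) : (c <= r)%N ->
  chart_minor (cell_mx M) c r = cell_mx M (v r) c.
Proof.
move=> cr; rewrite /chart_minor det_trig.
  rewrite big_ord_recr /= big1 => [|i _].
    rewrite mul1r mxE /chart_rows ltnn; congr (cell_mx M _ _); exact: val_inj.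
  by rewrite mxE /chart_rows /= ltn_ord cell_mxE ltnn eqxx.
apply/is_trig_mxP => i j ij; rewrite mxE /chart_rows.
have ic : (i < c)%N by have := ltn_ord j; lia.
rewrite ic cell_mxE /= [X in X && _]ltnNge [X in ~~ X]ltnW //=.
by case: eqP => // /(congr1 val) /= ij'; rewrite ij' ltnn in ij.
Qed.

End OppositeCell.

(** * The CI ideal as a rank condition on symmetric matrices *)

Section SymmetricPoints.
Variables (F : fieldType) (m : nat).

Definition sym_point (x : 'rV[F]_(nentries m)) : 'M[F]_m :=
  \matrix_(i, j) x 0 (enum_rank (sym_pair i j)).

Lemma map_generic_sym (x : 'rV[F]_(nentries m)) :
  map_mx (meval (fun i => x 0 i)) (generic_sym F m) = sym_point x.
Proof. by apply/matrixP => i j; rewrite !mxE mevalXU. Qed.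

Lemma zero_locus_CI (A B C : {set 'I_m}) (x : 'rV[F]_(nentries m)) :
  zero_locus (CI_ideal F A B C) x <->
  rank_on (mem (A :|: C)%SET) (mem (B :|: C)%SET) #|C| (sym_point x).
Proof.
have minorE k (f g : 'I_k -> 'I_m) :
    peval (\det (mxsub f g (generic_sym F m))) x = \det (mxsub f g (sym_point x)).
  by rewrite /peval -det_map_mx map_mxsub map_generic_sym.
rewrite rank_on_minors; split=> [xI d [f [g [hf hg fP gQ ->]]]|xI p [s [sG ->]]].
  rewrite -minorE; apply: xI; exists [:: (1, \det (mxsub f g (generic_sym F m)))].
  split=> [c|]; last by rewrite big_seq1 mul1r.
  by rewrite inE => /eqP ->; exists f, g.
rewrite /peval rmorph_sum big_seq big1 // => c /sG [f [g [hf hg fP gQ cE]]].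
move: (minorE _ f g); rewrite rmorphM /= cE /peval => ->.
by rewrite (xI (\det _)) ?mulr0 //; exists f, g.
Qed.

End SymmetricPoints.

(** * The isomorphism from corner data *)

Section KL.
Variables (F : numFieldType) (m n : nat) (v : 'S_n).
Hypothesis lt_mn : (m < n)%N.
Hypothesis v_first : forall r : 'I_n, (r <= m)%N -> v r = (n - m.+1 + r)%N :> nat.
Hypothesis v_last : forall r : 'I_n, (m < r)%N -> v r = (n - r.+1)%N :> nat.

(** A corner entry at column j < q and row v r >= n - p has r >= m + 1 - p >= q > j, so the corner
    consists of free entries of the normal form. Rows and columns are transposed, which swaps the
    two factors. *)
Lemma corner_rank_cell_mx p q e (M : 'M[F]_m) : (p + q <= m.+1)%N ->
  corner_rank p q e (cell_mx v M) <->
  rank_on (mem [set c : 'I_m | (c < q)%N]%SET)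
    (mem [set r : 'I_m | (m - p <= r)%N]%SET) e M.
Proof.
move=> le_pq; split=> [[a [b ab]]|[a [b ab]]].
  exists (fun c k => b (colx lt_mn c) k), (fun r k => a (v (rowx lt_mn r)) k).
  move=> c r; rewrite !inE => cq rp.
  have cr : (c <= r)%N by lia.
  rewrite -(cell_mx_coord v lt_mn M cr) ab ?inE //=; last first.
    have rm : (r < m)%N by exact: ltn_ord.
    rewrite v_first //= addnS; move: rp le_pq cq lt_mn rm; move: (nat_of_ord r) => r'.
    lia.
  by apply: eq_bigr => k _; rewrite mulrC.
exists (fun i k => if (insub ((v^-1)%g i).-1 : option 'I_m) is Some r then b r k else 0),
  (fun (j : 'I_n) k => if (insub (j : nat) : option 'I_m) is Some c then a c k else 0).
move=> i j; rewrite -(permKV v i); move: ((v^-1)%g i) => r; rewrite !inE permK => rp jq.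
(* Positions beyond m carry values too small to reach the last p rows; hence the default 0 in the
   witnesses is never met in the corner. *)
have rm : (r <= m)%N.
  rewrite leqNgt; apply/negP => mr; move: rp; rewrite v_last //.
  by have := ltn_ord r; lia.
have jr : (j < r)%N by move: rp; rewrite v_first //; lia.
have r1 : (r.-1 < m)%N by lia.
have j1 : (j < m)%N by lia.
rewrite cell_mxE jr rm /= nat_entry_ord !insubT ab ?inE //=.
  by apply: eq_bigr => k _; rewrite mulrC.
by move: rp; rewrite v_first //; lia.
Qed.

Let phi (k : 'I_(n * n)) : {mpoly F[nentries m]} :=
  mxvec (cell_mx v (generic_sym F m)) 0 k.

Lemma vec_cell_mx x : vec_mx (ratmap phi 1 x) = cell_mx v (sym_point x).
Proof.
rewrite -map_generic_sym -map_cell_mx; apply/matrixP => i j.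
by rewrite !mxE /peval meval1 divr1 /phi mxvecE mxE.
Qed.

Let chart_den (c : 'I_m) : {mpoly F[n * n]} :=
  chart_minor v (entries_mx F n) (colx lt_mn c) (colx lt_mn c).
(** The quotients of minors have different denominators; the product of all of them is the common
    one that [ratmap] requires. *)
Let d : {mpoly F[n * n]} := \prod_c chart_den c.
Let coord (k : 'I_(nentries m)) : 'I_m * 'I_m :=
  val (enum_val (k : 'I_#|{: sym_index m}|)).
Let a (k : 'I_(nentries m)) : {mpoly F[n * n]} :=
  chart_minor v (entries_mx F n) (colx lt_mn (coord k).1) (rowx lt_mn (coord k).2) *
  \prod_(c | c != (coord k).1) chart_den c.

Lemma peval_chart_minor y c r :
  peval (chart_minor v (entries_mx F n) c r) y = chart_minor v (vec_mx y) c r.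
Proof. exact: peval_minor. Qed.

Lemma chart_den_neq0 y : peval d y != 0 <->
  forall c, chart_minor v (vec_mx y) (colx lt_mn c) (colx lt_mn c) != 0.
Proof.
rewrite /d /peval rmorph_prod /=; split=> [/prodf_neq0 nz c|nz].
  by have := nz c isT; rewrite -/(peval _ y) peval_chart_minor.
by apply/prodf_neq0 => c _; rewrite -/(peval _ y) peval_chart_minor.
Qed.

Lemma chart_coordE y k : peval d y != 0 -> ratmap a d y 0 k =
  chart_minor v (vec_mx y) (colx lt_mn (coord k).1) (rowx lt_mn (coord k).2) /
  chart_minor v (vec_mx y) (colx lt_mn (coord k).1) (colx lt_mn (coord k).1).
Proof.
have dE : peval d y = peval (chart_den (coord k).1) y *
    peval (\prod_(c | c != (coord k).1) chart_den c) y.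
  by rewrite /d (bigD1 (coord k).1) //; exact: mevalM.
rewrite dE mulf_eq0 negb_or => /andP[_ nz]; rewrite mxE dE.
have -> : peval (a k) y = peval (chart_minor v (entries_mx F n)
    (colx lt_mn (coord k).1) (rowx lt_mn (coord k).2)) y *
    peval (\prod_(c | c != (coord k).1) chart_den c) y by exact: mevalM.
by rewrite -mulf_div divff // mulr1 !peval_chart_minor.
Qed.

Lemma chart_minor_mulmx A b c r : borel b -> chart_minor v (A *m b) c r =
  chart_minor v A c r *
    \det (mxsub (widen_ord (ltn_ord c)) (widen_ord (ltn_ord c)) b) :> F.
Proof. exact: minor_mulmx_borel. Qed.

(** Right multiplication by [b] scales all chart minors with the same c by one nonzero leading minor
    of [b], which cancels in the quotients. *)
Lemma chart_flag_inv (g h : GL F n) : flag_rel g h -> peval d (sval g) != 0 ->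
  peval d (sval h) != 0 /\ ratmap a d (sval h) = ratmap a d (sval g).
Proof.
rewrite /flag_rel /GL_mx => -[b bB hE] dg.
have dh : peval d (sval h) != 0.
  apply/chart_den_neq0 => c; rewrite hE chart_minor_mulmx // mulf_neq0 //.
    exact: (chart_den_neq0 _).1.
  exact: leading_minor_borel.
split=> //; apply/rowP => k; rewrite !chart_coordE // hE !chart_minor_mulmx //.
by rewrite -mulf_div divff ?mulr1 // leading_minor_borel.
Qed.

Lemma chart_den_cell_mx x : peval d (ratmap phi 1 x) != 0.
Proof.
apply/chart_den_neq0 => c; rewrite vec_cell_mx chart_minor_cell_mx // cell_mxE.
by rewrite ltnn eqxx oner_eq0.
Qed.

Lemma coord_le k : ((coord k).1 <= (coord k).2)%N.
Proof. exact: valP (enum_val (k : 'I_#|{: sym_index m}|)). Qed.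

Lemma sym_point_coord (x : 'rV[F]_(nentries m)) k :
  sym_point x (coord k).1 (coord k).2 = x 0 k.
Proof.
rewrite mxE; pose s := enum_val (k : 'I_#|{: sym_index m}|).
have -> : sym_pair (coord k).1 (coord k).2 = s.
  by apply: val_inj; rewrite /= coord_le -surjective_pairing.
by rewrite /s enum_valK.
Qed.

Lemma chart_cell_mx x : ratmap a d (ratmap phi 1 x) = x.
Proof.
apply/rowP => k; rewrite chart_coordE ?chart_den_cell_mx // vec_cell_mx.
have ck := coord_le k; rewrite !chart_minor_cell_mx //=; last exact: leqW.
by rewrite cell_mx_coord // sym_point_coord cell_mxE ltnn eqxx divr1.
Qed.

Lemma GL_cell_mx x : (vec_mx (ratmap phi 1 x) : 'M[F]_n) \in unitmx.
Proof. by rewrite vec_cell_mx cell_mx_unit. Qed.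

(** Common form of both cases. The chart always lands in the opposite cell, so only the corner
    condition has to be compared; conversely the normal form puts every point of that cell in the
    chart. *)
Lemma CI_variety_KL p q e (w : 'S_n) (A B C : {set 'I_m}) :
    (p + q <= m.+1)%N -> (e <= p)%N -> (e <= q)%N ->
    (forall j : 'I_n, (j < e)%N -> w j = rev_ord j) ->
    (forall i j : 'I_n, (j < i)%N -> (w j < w i)%N ->
       [/\ (e <= j)%N, (j < q)%N & (n - p <= w i)%N]) ->
    (forall j : 'I_n, (j < q)%N -> (n - p <= w j)%N -> (j < e)%N) ->
    #|C| = e -> (A :|: C)%SET = [set c : 'I_m | (c < q)%N]%SET ->
    (B :|: C)%SET = [set r : 'I_m | (m - p <= r)%N]%SET ->
  isomorphic (variety_of (CI_ideal F A B C)) (KL_variety F v w).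
Proof.
move=> le_pq le_ep le_eq w_top w_noninv w_corner cardC AC BC.
have le_en : (e <= n)%N by lia.
apply: (@chart_isomorphic F _ _ _ _ (@flag_rel_refl F n) (@flag_rel_sym F n)
  (@flag_rel_trans F n) phi a d GL_cell_mx chart_den_cell_mx chart_cell_mx chart_flag_inv).
  move=> x; pose g : GL F n := exist
    (fun y : 'rV[F]_(n * n) => is_true ((vec_mx y : 'M[F]_n) \in unitmx)) _ (GL_cell_mx x).
  have gE : GL_mx g = cell_mx v (sym_point x) by rewrite -vec_cell_mx.
  have gv : cell (@borel_opp F n) v (@quot_pi F (GL F n) (@flag_rel F n) g).
    exists g => //; exists (to_opp v (sym_point x)), 1%:M; split.
    - exact: to_opp_borel.
    - exact: borel1.
    - by rewrite gE to_oppE mulmx1.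
  rewrite zero_locus_CI AC BC cardC -corner_rank_cell_mx // -gE.
  rewrite -(closure_cellP le_ep le_eq le_en w_top w_noninv w_corner).
  by split=> [?|[]].
move=> _ [_ [g [h [b [hB bB gE]]] <-]].
have [M [U [UB hU]]] := opp_cell_normal_form lt_mn v_first v_last hB.
pose x : 'rV[F]_(nentries m) := \row_k M (coord k).1 (coord k).2.
exists x; apply/piG_eq/flag_rel_sym; exists (U *m b); first exact: borelM.
rewrite gE hU mulmxA /GL_mx /= vec_cell_mx; congr (_ *m _ *m _).
apply: (cell_mx_upper v lt_mn) => i j ij; rewrite !mxE /coord enum_rankK /=.
by rewrite ij.
Qed.

End KL.

(** * Reading off one-line notation *)

Section OneLine.

Lemma nth_oneline n (w : 'S_n) (j : 'I_n) : nth 0%N (oneline w) j = (w j).+1.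
Proof.
by rewrite (nth_map j) ?size_enum_ord // nth_ord_enum.
Qed.

Lemma size_decr_run a b : size (decr_run a b) = (a.+1 - b)%N.
Proof. by rewrite size_rev size_iota. Qed.

Lemma nth_decr_run a b i : (i < a.+1 - b)%N -> nth 0%N (decr_run a b) i = (a - i)%N.
Proof. by move=> h; rewrite nth_rev ?size_iota // nth_iota; lia. Qed.

Lemma nth_incr_run a b i : (i < b.+1 - a)%N -> nth 0%N (incr_run a b) i = (a + i)%N.
Proof. exact: nth_iota. Qed.

Lemma size_incr_run a b : size (incr_run a b) = (b.+1 - a)%N.
Proof. exact: size_iota. Qed.

End OneLine.

End KazhdanLusztigCI.

Theorem lemma5p11 (R : realType) (m n : nat) (A B C : {set 'I_m})
    (v w : 'S_n)
    (disjAB : [disjoint A & B]) (disjAC : [disjoint A & C])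
    (disjBC : [disjoint B & C])
    (le_m1_n : (m + 1 <= n)%N)
    (def_v : oneline v = incr_run (n - m) n ++ decr_run (n - m - 1) 1)
    (cond :
      (exists k l : nat,
        [/\ (l + k <= m)%N,
            oneline w = decr_run (n - l) (n - l - k + 1)
                        ++ decr_run n (n - l + 1)
                        ++ decr_run (n - l - k) 1,
            A = interval_set m 1 k,
            B = interval_set m (m - l + 1) m &
            C = set0])
      \/
      (exists s t k l : nat,
        [/\ k = (1 + s)%N, l = (1 + t)%N & (l + k = m + 1)%N]
        /\ [/\ oneline w = n :: decr_run (n - 1 - t) (n - t - s)
                             ++ decr_run (n - 1) (n - t)
                             ++ decr_run (n - t - s - 1) 1,
               A = interval_set m 1 (k - 1),
               B = interval_set m (k + 1) m &
               C = interval_set m k k])) :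
  isomorphic (variety_of (CI_ideal (complex R) A B C))
             (KL_variety (complex R) v w).

Proof.
have lt_mn : (m < n)%N by rewrite -addn1.
have vE (r : 'I_n) : (v r).+1 = nth 0%N (oneline v) r by rewrite nth_oneline.
have v_first (r : 'I_n) : (r <= m)%N -> v r = (n - m.+1 + r)%N :> nat.
  move=> rm; move: (vE r); rewrite def_v nth_cat size_incr_run.
  by case: ifP => ?; [rewrite nth_incr_run //|]; lia.
have v_last (r : 'I_n) : (m < r)%N -> v r = (n - r.+1)%N :> nat.
  move=> rm; have rn := ltn_ord r; move: (vE r); rewrite def_v nth_cat size_incr_run.
  by case: ifP => ?; [|rewrite nth_decr_run]; lia.
case: cond => [[k [l [le_lk def_w AE BE CE]]]|[s [t [k [l [[kE lE le_lk] [def_w AE BE CE]]]]]]].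
(* The branches are the three blocks of the word, with positions counted from 0 and values from
   1. *)
- have wE (j : 'I_n) : (w j).+1 =
      (if (j < k)%N then n - l - j else if (j < l + k)%N then n - (j - k) else n - j)%N.
    have jn := ltn_ord j; rewrite -nth_oneline def_w !nth_cat !size_decr_run.
    by do 4?[case: ifP => ?]; rewrite ?nth_decr_run; lia.
  (* Rows of the corner come from B, of size l, and columns from A, of size k; rank 0 since C is
     empty. *)
  apply: (@CI_variety_KL _ _ _ _ lt_mn v_first v_last l k 0%N) => //.
  + lia.
  + move=> i j ji wji; apply/and3P; move: (wE i) (wE j) (ltn_ord i) (ltn_ord j).
    by do 4?[case: ifP => ?]; lia.
  + by move=> j; move: (wE j) (ltn_ord j); do 2?[case: ifP => ?]; lia.
  + by rewrite CE cards0.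
  + by rewrite CE setU0 AE; apply/setP => i; rewrite !inE.
  + rewrite CE setU0 BE; apply/setP => i; rewrite !inE; have := ltn_ord i; lia.
- have wE (j : 'I_n) : (w j).+1 = (if j == 0 :> nat then n else
      if (j <= s)%N then n - t - j else if (j <= s + t)%N then n - (j - s) else n - j)%N.
    have jn := ltn_ord j; rewrite -nth_oneline def_w.
    case: (nat_of_ord j) jn => [|i] jn //=; rewrite !nth_cat !size_decr_run.
    by do 4?[case: ifP => ?]; rewrite ?nth_decr_run; lia.
  (* Now B and A together with C have sizes l and k, and the leading value n of [w] accounts for the
     rank 1. *)
  apply: (@CI_variety_KL _ _ _ _ lt_mn v_first v_last l k 1%N) => //; try lia.
  + by move=> j j0; apply: val_inj; move: (wE j) (ltn_ord j) => /=; case: ifP => ?; lia.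
  + move=> i j ji wji; apply/and3P; move: (wE i) (wE j) (ltn_ord i) (ltn_ord j).
    by do 6?[case: ifP => ?]; lia.
  + by move=> j; move: (wE j) (ltn_ord j); do 3?[case: ifP => ?]; lia.
  (* As l >= 1, the element k belongs to [m]; counted from 0 it is k - 1. *)
  + have km : (k.-1 < m)%N by lia.
    suff -> : C = [set Ordinal km]%SET by rewrite cards1.
    by rewrite CE; apply/setP => i; rewrite !inE -val_eqE /=; lia.
  + by rewrite AE CE; apply/setP => i; rewrite !inE; lia.
  + by rewrite BE CE; apply/setP => i; rewrite !inE; have := ltn_ord i; lia.
Qed.
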